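(* In the setting of the context (a weighted genus two admissible cover over the standard log point, with real-metrised tropicalisation $\Gamma$, associated function $\lambda$, and $\rho_1$ the value of $\lambda$ on the special vertex or vertices), the subcurve $\Gamma_{\ge\rho_1}=\{x\in\Gamma:\lambda(x)\ge\rho_1\}$ contains the core, i.e. the minimal subcurve of genus two of $\Gamma$.
   Context: *Admissible cover.* Over $\mathbb C$, let $\psi\colon(C,D_R)\to(T,D_B)$ be a hyperelliptic admissible cover: a finite degree two morphism of nodal curves, $C$ connected of arithmetic genus $2$, $T$ of genus $0$, étale on $C^{sm}\setminus D_R$, simply ramified along the six smooth points $D_R$ mapping to six distinct smooth points $D_B$, mapping nodes to nodes with the same ramification order $1$ or $2$ on both branches. It carries a weight $w\colon V(\Gamma)\to\mathbb N$ on the dual graph of $C$, not identically zero, such that with $w_T(v)=\sum_{v'\mapsto v}w(v')$ every component of $T$ with $w_T=0$ has at least three nodes or branch points. *Metric.* $\Gamma=\mathrm{trop}(C)$ and the tree $\Gamma_T=\mathrm{trop}(T)$ are the dual graphs with positive real edge lengths, where the length of an edge of $\Gamma_T$ is the ramification order (expansion factor) times the length of any edge of $\Gamma$ above it; $\mathrm{trop}(\psi)\colon\Gamma\to\Gamma_T$ is the induced harmonic map of degree two. For a subcurve, genus means arithmetic genus: first Betti number plus sum of vertex genera. *Functions.* A piecewise linear (PL) function has integral slopes on (a subdivision of) $\Gamma$ (half-integral slopes allowed on $\Gamma_T$); $\mathrm{div}(\lambda)(v)$ is the sum of outgoing slopes at $v$; $K_\Gamma(v)=2g(v)-2+\mathrm{val}(v)$.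 Pullback along $\mathrm{trop}(\psi)$ composes functions and multiplies divisors by local degrees. On $\Gamma_T$ let $D'(v)=\mathrm{val}(v)-2+\tfrac12\deg(D_B|_v)$ (valence counts edges only); it has degree $1$ and pulls back to $K_\Gamma$. For each vertex $v_0$ of $\Gamma_T$ there is a PL function $\overline\lambda_T$, unique up to constants, with $D'+\mathrm{div}(\overline\lambda_T)=v_0$; its pullback to $\Gamma$ is an *admissible function*. Let $\overline\lambda_1,\dots,\overline\lambda_s$ be all of them and let $\lambda_i$ be $\overline\lambda_i$ shifted by a constant so that vertices with $\lambda_i>0$ have weight $0$ while those with $\lambda_i\ge0$ have total weight $\ge1$ (i.e. the maximum of $\lambda_i$ on vertices of positive weight is $0$). Define $\lambda=\max\{0,\lambda_1,\dots,\lambda_s\}$, a PL function on a subdivision of $\Gamma$, pulled back from $\lambda_T$ on $\Gamma_T$. Put $\Delta^\circ=\{\lambda>0\}$ and let $\Delta$ be the minimal subcurve of genus two containing the closure of $\Delta^\circ$, $\Delta_T$ its image in $\Gamma_T$. With $D'$ computed using valences in $\Delta_T$, $D=D'+\mathrm{div}(\lambda_T)$ is an effective divisor of degree $1$ with half-integral coefficients on $\Delta_T$ and $\mathrm{trop}(\psi)^*D=K_\Delta+\mathrm{div}(\lambda)$ on $\Delta$. The point(s) supporting $D$, and their preimages in $\Gamma$, are called special; if $D$ is half the sum of two distinct points then $\lambda$ is $0$ at both, so the value $\rho_1\ge0$ of $\lambda$ on the special vertex(ices) is well defined. *)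

(* Defs.v *)
From HB Require Import structures.
From mathcomp Require Import all_boot all_order all_algebra.
From mathcomp Require Import boolp classical_sets reals.

Set Implicit Arguments.
Unset Strict Implicit.
Unset Printing Implicit Defensive.

Import Order.TTheory GRing.Theory Num.Theory.

Local Open Scope classical_set_scope.
Local Open Scope ring_scope.

(* Multigraphs with vertex genera.  The orientation of the edges is only used *)
(* to name their two ends.                                                    *)

Record graph := Graph {
  gV : finType;
  gE : finType;
  src : gE -> gV;
  tgt : gE -> gV;
  genus : gV -> nat }.

(* The half-edge (e, false) is based at src e, and (e, true) at tgt e. *)
Definition halfedge (G : graph) : finType := (gE G * bool)%type.

Definition hroot (G : graph) (h : halfedge G) : gV G :=
  if h.2 then tgt h.1 else src h.1.

Definition val_at (G : graph) (v : gV G) : nat :=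
  #|[pred h : halfedge G | hroot h == v]|.

Definition is_subgraph (G : graph) (A : {set gV G}) (B : {set gE G}) : Prop :=
  forall e, e \in B -> (src e \in A) && (tgt e \in A).

Definition adjacent (G : graph) (B : {set gE G}) : rel (gV G) :=
  fun u v => [exists e in B,
    ((src e == u) && (tgt e == v)) || ((src e == v) && (tgt e == u))].

Definition connected_subgraph (G : graph) (A : {set gV G}) (B : {set gE G}) :
  Prop :=
  (exists u, u \in A) /\
  (forall u v, u \in A -> v \in A -> connect (adjacent B) u v).

(* First Betti number of a connected subgraph. *)
Definition betti1 (G : graph) (A : {set gV G}) (B : {set gE G}) : int :=
  #|B|%:Z - #|A|%:Z + 1.

Definition arith_genus (G : graph) (A : {set gV G}) (B : {set gE G}) : int :=
  betti1 A B + \sum_(v in A) (genus v)%:Z.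

Definition connected_of_genus (G : graph) (A : {set gV G}) (B : {set gE G})
    (n : nat) : Prop :=
  [/\ is_subgraph A B, connected_subgraph A B & arith_genus A B = n%:Z].

(* Metric graphs, their points, directions and slopes. *)

Record mgraph (R : realType) := MGraph {
  mgraph_graph :> graph;
  len : gE mgraph_graph -> R;
  len_gt0 : forall e, 0 < len e }.

Section MetricGraph.
Variables (R : realType) (G : mgraph R).

(* A pair (e, t) stands for the point at distance t from src e on e. *)
Definition edge_point := {x : gE G * R | 0 < x.2 < len x.1}.

Definition mpoint := (gV G + edge_point)%type.

(* The point of coordinate t on e; t is clamped to the interval [0, len e]. *)
Definition epoint (e : gE G) (t : R) : mpoint :=
  if insub (e, t) is Some x then inr x
  else if t <= 0 then inl (src e) else inl (tgt e).

(* Tangent directions at a point: at an interior point of e, (e, false) is    *)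
(* the direction of increasing coordinate and (e, true) the opposite one.     *)
Definition dirs (p : mpoint) : pred (halfedge G) :=
  match p with
  | inl v => fun h => hroot h == v
  | inr x => fun h => h.1 == (val x).1
  end.

Definition coord (p : mpoint) (h : halfedge G) : R :=
  match p with
  | inl _ => if h.2 then len h.1 else 0
  | inr x => (val x).2
  end.

(* The point at distance s from p in the direction h, for h in dirs p and     *)
(* s small.                                                                   *)
Definition travel (p : mpoint) (h : halfedge G) (s : R) : mpoint :=
  epoint h.1 (if h.2 then coord p h - s else coord p h + s).

Definition closure_pt (S : set mpoint) : set mpoint :=
  [set p | S p \/ forall eps : R, 0 < eps ->
    exists h : halfedge G, dirs p h /\
    exists2 s : R, 0 < s < eps & S (travel p h s)].

Definition tangent_to (S : set mpoint) (p : mpoint) (h : halfedge G) : Prop :=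
  exists2 eps : R, 0 < eps & forall s : R, 0 <= s <= eps -> S (travel p h s).

Definition dirs_in (S : set mpoint) (p : mpoint) : pred (halfedge G) :=
  fun h => dirs p h && `[< tangent_to S p h >].

Definition is_slope (f : mpoint -> R) (p : mpoint) (h : halfedge G) (m : R) :=
  exists2 eps : R, 0 < eps &
    forall s : R, 0 <= s <= eps -> f (travel p h s) = f p + m * s.

Definition slope (f : mpoint -> R) (p : mpoint) (h : halfedge G) : R :=
  xget 0 [set m | is_slope f p h m].

Definition pdiv (f : mpoint -> R) (p : mpoint) : R :=
  \sum_(h : halfedge G | dirs p h) slope f p h.

(* Divisor of the restriction of f to S. *)
Definition pdiv_on (S : set mpoint) (f : mpoint -> R) (p : mpoint) : R :=
  \sum_(h : halfedge G | dirs_in S p h) slope f p h.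

(* Subdivisions: c e lists the new vertices on the edge e. *)

Definition valid_cuts (c : gE G -> seq R) : Prop :=
  forall e, path <%R 0 (rcons (c e) (len e)).

Definition breakpoint (c : gE G -> seq R) (e : gE G) (k : nat) : R :=
  nth 0 (0 :: rcons (c e) (len e)) k.

(* Continuous piecewise linear functions with slopes in (1/n)Z. *)
Definition is_PL (n : nat) (f : mpoint -> R) : Prop :=
  exists2 c, valid_cuts c &
    forall (e : gE G) (k : nat), (k <= size (c e))%N ->
    exists z : int, forall t : R,
      breakpoint c e k <= t <= breakpoint c e k.+1 ->
      f (epoint e t) = f (epoint e (breakpoint c e k))
                       + z%:~R / n%:R * (t - breakpoint c e k).

(* The subdivided graph: the k-th piece of e goes from breakpoint c e k to    *)
(* breakpoint c e k.+1; unlift ord0 k is None for k = 0 and Some k.-1         *)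
(* otherwise, and unlift ord_max k is None on the last piece, else Some k.    *)
Section Subdivision.
Variable c : gE G -> seq R.

Definition subdV : finType := (gV G + {e : gE G & 'I_(size (c e))})%type.
Definition subdE : finType := {e : gE G & 'I_(size (c e)).+1}.

Definition subd_src (x : subdE) : subdV :=
  if unlift ord0 (tagged x) is Some i
  then inr (existT (fun e => 'I_(size (c e))) (tag x) i)
  else inl (src (tag x)).

Definition subd_tgt (x : subdE) : subdV :=
  if unlift ord_max (tagged x) is Some i
  then inr (existT (fun e => 'I_(size (c e))) (tag x) i)
  else inl (tgt (tag x)).

Definition subd_genus (u : subdV) : nat :=
  match u with inl v => genus v | inr _ => 0%N end.

Definition subdivision : graph := Graph subd_src subd_tgt subd_genus.

Definition vertex_point (u : gV subdivision) : mpoint :=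
  match u with
  | inl v => inl v
  | inr x => epoint (tag x) (nth 0 (c (tag x)) (tagged x))
  end.

Definition realization (A : {set gV subdivision}) (B : {set gE subdivision}) :
  set mpoint :=
  [set p | (exists2 u, u \in A & p = vertex_point u) \/
           (exists2 x, x \in B & exists2 t : R,
              breakpoint c (tag x) (tagged x) <= t
                <= breakpoint c (tag x) (tagged x).+1 &
              p = epoint (tag x) t)].

End Subdivision.

(* A (connected) subcurve of genus n: a subgraph of some subdivision. *)
Definition subcurve_of_genus (n : nat) (S : set mpoint) : Prop :=
  exists2 c, valid_cuts c &
  exists (A : {set gV (subdivision c)}) (B : {set gE (subdivision c)}),
    connected_of_genus A B n /\ S = realization A B.

Definition minimal_genus2_containing (X S : set mpoint) : Prop :=
  [/\ subcurve_of_genus 2%N S, X `<=` S &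
      forall S', subcurve_of_genus 2%N S' -> X `<=` S' -> S' `<=` S -> S' = S].

Definition is_core (S : set mpoint) : Prop := minimal_genus2_containing set0 S.

End MetricGraph.

(* Tropical data of a weighted hyperelliptic admissible cover of genus two:   *)
(* the morphism of dual graphs C -> T, with the discrete invariants of the    *)
(* restriction of psi to each component.                                      *)

Record weighted_cover (R : realType) := WeightedCover {
  Gam : mgraph R;
  Tree : mgraph R;
  phiV : gV Gam -> gV Tree;
  phiE : gE Gam -> gE Tree;
  (* ramification order at the node e *)
  expansion : gE Gam -> nat;
  (* degree of psi on the component v *)
  degree : gV Gam -> nat;
  (* component of C carrying the i-th point of D_R *)
  ram_pt : 'I_6 -> gV Gam;
  weight : gV Gam -> nat;
  Gam_genus2 : connected_of_genus [set: gV Gam]%SET [set: gE Gam]%SET 2%N;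
  Tree_genus0 : connected_of_genus [set: gV Tree]%SET [set: gE Tree]%SET 0%N;
  phi_src : forall e, phiV (src e) = src (phiE e);
  phi_tgt : forall e, phiV (tgt e) = tgt (phiE e);
  expansion12 : forall e, (expansion e == 1%N) || (expansion e == 2%N);
  phi_len : forall e, len (phiE e) = (expansion e)%:R * len e;
  degree_gt0 : forall v, (0 < degree v)%N;
  degree2 : forall v' : gV Tree, (\sum_(v | phiV v == v') degree v = 2)%N;
  (* the ramification orders at the preimages on the component v of a branch  *)
  (* h' at phiV v of a node of T add up to degree v                           *)
  harmonic : forall (v : gV Gam) (h' : halfedge Tree), hroot h' = phiV v ->
    (\sum_(h : halfedge Gam |
            [&& hroot h == v, phiE h.1 == h'.1 & h.2 == h'.2])
       expansion h.1 = degree v)%N;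
  ram_degree : forall i, degree (ram_pt i) = 2%N;
  (* psi is simply ramified along D_R and etale on the rest of the smooth     *)
  (* locus                                                                    *)
  riemann_hurwitz : forall v : gV Gam,
    2 * (genus v)%:Z - 2 =
    (degree v)%:Z * (2 * (genus (phiV v))%:Z - 2)
      + #|[pred i | ram_pt i == v]|%:Z
      + \sum_(h : halfedge Gam | hroot h == v) ((expansion h.1)%:Z - 1);
  weight_neq0 : exists v, (0 < weight v)%N;
  stable : forall v' : gV Tree,
    (\sum_(v | phiV v == v') weight v = 0)%N ->
    (3 <= val_at v' + #|[pred i | phiV (ram_pt i) == v']|)%N }.

Section Cover.
Variables (R : realType) (X : weighted_cover R).

Local Notation G := (Gam X).
Local Notation T := (Tree X).

Definition trop (p : mpoint G) : mpoint T :=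
  match p with
  | inl v => inl (phiV v)
  | inr x => epoint (phiE (val x).1) ((expansion (val x).1)%:R * (val x).2)
  end.

(* deg (D_B|_p) *)
Definition branch_at (p : mpoint T) : nat :=
  match p with
  | inl v' => #|[pred i | phiV (@ram_pt R X i) == v']|
  | inr _ => 0%N
  end.

(* The divisor D' on Gamma_T. *)
Definition Dprime (p : mpoint T) : R :=
  #|dirs p|%:R - 2 + (branch_at p)%:R / 2.

Definition admissible_at (v0 : gV T) (f : mpoint T -> R) : Prop :=
  is_PL 2%N f /\ forall p : mpoint T, Dprime p + pdiv f p = (p == inl v0)%:R.

Definition weight_normalized (f : mpoint G -> R) : Prop :=
  (forall v : gV G, 0 < f (inl v) -> weight v = 0%N) /\
  (1 <= \sum_(v : gV G | (0 <= f (inl v))%R) weight v)%N.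

(* lam v0 descends the function lambda_i attached to v0. *)
Definition shifted_admissible_family (lam : gV T -> mpoint T -> R) : Prop :=
  forall v0, admissible_at v0 (lam v0) /\ weight_normalized (lam v0 \o trop).

Definition lambda_T (lam : gV T -> mpoint T -> R) (p : mpoint T) : R :=
  \big[Num.max/0]_(v0 : gV T) lam v0 p.

Definition lambda (lam : gV T -> mpoint T -> R) : mpoint G -> R :=
  lambda_T lam \o trop.

Definition is_Delta (lam : gV T -> mpoint T -> R) (Delta : set (mpoint G)) :=
  minimal_genus2_containing (closure_pt [set x | 0 < lambda lam x]) Delta.

Definition ramified_edge (e' : gE T) : bool :=
  [exists e : gE G, (phiE e == e') && (expansion e == 2%N)].

(* The divisor D' of Delta_T.  The branch points of Delta -> Delta_T at p are *)
(* those in D_B, together with the ramified directions at p along which       *)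
(* Delta_T is cut off: at such a direction the component of the subcurve keeps *)
(* the corresponding ramification point, now a smooth point.  This is the     *)
(* divisor that has degree 1 and pulls back to K_Delta.                       *)
Definition Dprime_on (S : set (mpoint T)) (p : mpoint T) : R :=
  #|dirs_in S p|%:R - 2
  + (branch_at p
     + #|[pred h | [&& dirs p h, ~~ dirs_in S p h & ramified_edge h.1]]|)%:R
    / 2.

Definition special_divisor (lam : gV T -> mpoint T -> R)
    (Delta : set (mpoint G)) (p : mpoint T) : R :=
  Dprime_on (trop @` Delta) p + pdiv_on (trop @` Delta) (lambda_T lam) p.

(* Special points of Gamma: preimages of the support of D. *)
Definition special (lam : gV T -> mpoint T -> R) (Delta : set (mpoint G)) :
  set (mpoint G) :=
  [set q | (trop @` Delta) (trop q) /\ special_divisor lam Delta (trop q) != 0].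

(* rho is the value of lambda on some special point.  As lambda takes the same *)
(* value on all special points, this characterizes rho_1.                     *)
Definition is_rho1 (lam : gV T -> mpoint T -> R) (Delta : set (mpoint G))
    (rho : R) : Prop :=
  exists2 q, special lam Delta q & lambda lam q = rho.

Definition superlevel (lam : gV T -> mpoint T -> R) (rho : R) :
  set (mpoint G) := [set x | rho <= lambda lam x].

End Cover.

(* Main.v *)
(** On the tree, let [far h] be the component beyond the half-edge [h] and let
    [branches h] count the branch points in it.  The function attached to [v0]
    has slope [branches h / 2 - 1 - [v0 \in far h]] along [h].  Suppose that
    [lambda] is positive at a special point [p].  For every direction [h] at [p]
    some function attaining the maximum at [p] has [v0 \notin far h]: otherwise
    all the functions attaining the maximum have the same slopes at [p], and the
    special divisor vanishes there.  Along a path starting in the direction [h],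
    this function is nondecreasing as long as [branches >= 2].  By
    Riemann-Hurwitz, the part of the cover over [far k] is a forest of rational
    components when [branches k <= 1]; as the core has no rational leaf, it does
    not meet that part, so the path from [p] to any point of the core is
    ascending. *)

Require Import Defs.
From mathcomp Require Import all_boot all_order all_algebra.
From mathcomp Require Import boolp classical_sets reals.
From mathcomp Require Import zify lra ring.

Set Implicit Arguments.
Unset Strict Implicit.
Unset Printing Implicit Defensive.

Import Order.TTheory GRing.Theory Num.Theory.

(** * Half-edges and connectedness *)

Section HalfEdges.
Variable G : graph.
Implicit Types (h k : halfedge G) (u v w : gV G) (B : {set gE G}).

Definition hopp h : halfedge G := (h.1, ~~ h.2).
Definition hend h : gV G := hroot (hopp h).

Lemma hoppK : involutive hopp.
Proof. by case=> e b; rewrite /hopp /= negbK. Qed.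

Lemma hend_hopp h : hend (hopp h) = hroot h.
Proof. by rewrite /hend hoppK. Qed.

Lemma hopp_neq h : hopp h != h.
Proof. by case: h => e []; rewrite xpair_eqE eqxx. Qed.

Lemma same_edge h k : h.1 = k.1 -> k = h \/ k = hopp h.
Proof.
case: h k => [e b] [e' b'] /= <-; rewrite /hopp /=.
by case: b b' => [] []; [left|right|right|left].
Qed.

Lemma adjacentP B u v :
  reflect (exists h, [/\ h.1 \in B, hroot h = u & hend h = v])
          (adjacent B u v).
Proof.
apply: (iffP existsP) => [[e /andP[eB /orP[]/andP[/eqP<- /eqP<-]]]|[[e b]]].
- by exists (e, false).
- by exists (e, true).
- move=> [/= eB <- <-]; exists e; rewrite eB /hend /hroot /=.
  by case: b; rewrite /= !eqxx ?orbT.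
Qed.

Lemma adjacent_sym B : symmetric (adjacent B).
Proof.
move=> u v; apply/idP/idP => /adjacentP[h [hB <- <-]]; apply/adjacentP;
  by exists (hopp h); rewrite hend_hopp.
Qed.

Lemma connect_adjacentC B u v :
  connect (adjacent B) u v = connect (adjacent B) v u.
Proof. exact: (sym_connect_sym (@adjacent_sym B)). Qed.

Lemma connect_adj B h : h.1 \in B -> connect (adjacent B) (hroot h) (hend h).
Proof. by move=> hB; apply/connect1/adjacentP; exists h. Qed.

Lemma connect_elim B u (P : gV G -> Prop) :
  P u ->
  (forall h, h.1 \in B -> connect (adjacent B) u (hroot h) ->
     P (hroot h) -> P (hend h)) ->
  forall v, connect (adjacent B) u v -> P v.
Proof.
move=> Pu step v /connectP[p]; elim/last_ind: p v => [|p x IH] v /=.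
  by move=> _ ->.
rewrite rcons_path last_rcons => /andP[pth adj] ->.
have /adjacentP[h [hB r <-]] := adj.
apply: step => //; last by rewrite r; apply: IH.
by rewrite r; apply/connectP; exists p.
Qed.

(* Grow a connected set one vertex at a time, each time along a new edge. *)
Lemma card_connected B :
  (forall u v, connect (adjacent B) u v) -> (#|gV G| <= #|B| + 1)%N.
Proof.
move=> conn; case: (posnP #|gV G|) => [->//|n_gt0].
pose inner (S : {set gV G}) :=
  [set e in B | (src e \in S) && (tgt e \in S)]%SET.
have grow n : (n < #|gV G|)%N ->
  exists2 S : {set gV G}, #|S| = n.+1 & (n <= #|inner S|)%N.
  elim: n => [_|n IH lt_n].
    by have /card_gt0P[u _] := n_gt0; exists [set u]%SET; rewrite ?cards1.
  have [S cS ineq] := IH (ltnW lt_n).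
  have [h [hB hS hnS]] : exists h,
      [/\ h.1 \in B, hroot h \in S & hend h \notin S].
    have /card_gt0P[u uS] : (0 < #|S|)%N by rewrite cS.
    case: (pickP [pred h : halfedge G |
       [&& h.1 \in B, hroot h \in S & hend h \notin S]]) => [h /and3P[]|no].
      by exists h.
    have all v : v \in S.
      move: v (conn u v); apply: connect_elim => // h hB _ hS.
      by have := no h; rewrite /= hB hS /= => /negbFE.
    move: lt_n; rewrite -cS -cardsT.
    suff -> : S = [set: gV G]%SET by rewrite ltnn.
    by apply/setP => v; rewrite all inE.
  exists (hend h |: S)%SET; first by rewrite cardsU1 hnS cS.
  have hnI : h.1 \notin inner S.
    rewrite inE hB /=; move: hnS; rewrite /hend /hroot /=.
    by case: (h.2) => /= /negbTE->; rewrite ?andbF.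
  apply: leq_trans (_ : #|h.1 |: inner S|%SET <= _)%N.
    by rewrite cardsU1 hnI ltnS.
  apply/subset_leq_card/fintype.subsetP => e; rewrite !inE.
  case/orP => [/eqP->|/and3P[-> -> ->]]; last by rewrite !orbT.
  rewrite hB /=; move: hS; rewrite /hend /hroot /=.
  by case: (h.2) => /= ->; rewrite !eqxx ?orbT.
have [|S cS] := grow #|gV G|.-1; first by rewrite prednK.
move=> /leq_trans -/(_ #|B|); rewrite addn1.
have -> : (#|inner S| <= #|B|)%N.
  by apply/subset_leq_card/fintype.subsetP => e; rewrite inE => /andP[].
by move=> /(_ isT); lia.
Qed.

End HalfEdges.

(** * Trees *)

Section Trees.
Variable T : graph.
Hypothesis T_tree : connected_of_genus [set: gV T]%SET [set: gE T]%SET 0%N.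
Implicit Types (h k : halfedge T) (u v w z : gV T).

Lemma tree_connect u v : connect (adjacent [set: gE T]%SET) u v.
Proof. by case: T_tree => _ [_ conn] _; apply: conn; rewrite inE. Qed.

Lemma tree_card_genus :
  (#|gE T| + 1 = #|gV T|)%N /\ forall v, genus v = 0%N.
Proof.
have := card_connected tree_connect.
case: T_tree => _ _; rewrite /arith_genus /betti1 !cardsT => eq0 le.
have eqN : (#|gE T| + 1 + \sum_(v in [set: gV T]%SET) genus v = #|gV T|)%N.
  move: eq0; rewrite -(big_morph Posz PoszD (erefl _)); lia.
have s0 : (\sum_(v in [set: gV T]%SET) genus v = 0)%N by lia.
split=> [|v]; first lia.
by move/eqP: s0; rewrite sum_nat_eq0 => /forallP/(_ v); rewrite inE => /eqP.
Qed.

Lemma tree_genus v : genus v = 0%N.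
Proof. by have [_] := tree_card_genus. Qed.

Definition far h : {set gV T} :=
  [set v | connect (adjacent ([set: gE T] :\ h.1)) (hend h) v]%SET.

Lemma hend_far h : hend h \in far h.
Proof. by rewrite inE connect0. Qed.

Lemma far_step h k : hroot k \in far h -> k.1 != h.1 -> hend k \in far h.
Proof.
rewrite !inE => /connect_trans c ne; apply: c; apply: connect_adj.
by rewrite !inE ne.
Qed.

Lemma hroot_far h : hroot h \notin far h.
Proof.
apply/negP; rewrite inE => cyc.
pose B := ([set: gE T] :\ h.1)%SET.
have conn u v : connect (adjacent B) u v.
  move: v (tree_connect u v); apply: connect_elim.
    exact: connect0.
  move=> k _ _ /connect_trans c; apply: c.
  case: (eqVneq k.1 h.1) => [kh|kh]; last first.
    by apply: connect_adj; rewrite !inE kh.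
  case: (same_edge (esym kh)) => ->.
    by rewrite connect_adjacentC.
  by rewrite hend_hopp.
have := card_connected conn; have [<- _] := tree_card_genus.
have := cardsD1 h.1 [set: gE T]%SET; rewrite inE cardsT /= -/B => ->.
by lia.
Qed.

Lemma hroot_neq_hend h : hroot h != hend h.
Proof. by apply: contraNneq (hroot_far h) => ->; apply: hend_far. Qed.

Lemma far_elim h (P : gV T -> Prop) :
  P (hend h) ->
  (forall k, k.1 != h.1 -> hroot k \in far h -> P (hroot k) -> P (hend k)) ->
  forall v, v \in far h -> P v.
Proof.
move=> P0 st v; rewrite inE; move: v; apply: connect_elim => // k.
by rewrite !inE andbT => kh c'; apply: st; rewrite ?inE.
Qed.

Lemma far_hopp h v : (v \in far (hopp h)) = (v \notin far h).
Proof.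
apply/idP/idP => [|].
  rewrite !inE hend_hopp => c; apply: contra (hroot_far h) => c'.
  rewrite inE; apply: (connect_trans c').
  by rewrite connect_adjacentC.
apply: contraNT; move: v.
have all v : (v \in far h) \/ (v \in far (hopp h)).
  move: v (tree_connect (hend h) v); apply: connect_elim.
    by left; rewrite hend_far.
  move=> k _ _; case: (eqVneq k.1 h.1) => [kh|kh].
    case: (same_edge (esym kh)) => -> _.
      by left; apply: hend_far.
    by right; apply: hend_far.
  by case=> [|] /far_step st; [left|right]; apply: st.
by move=> v; case: (all v) => ->.
Qed.

Lemma far_sub h k : hend k \in far h -> hroot h \notin far k ->
  {subset far k <= far h}.
Proof.
move=> hk nr v vk; move: v vk; apply: far_elim => // k' kk' k'k k'h.
apply: far_step => //.
apply: contraNneq nr => e.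
case: (same_edge e) => E; last by rewrite E; apply: far_step.
by move: k'h; rewrite -E (negbTE (hroot_far _)).
Qed.

Lemma no_loop h k : hroot h = hroot k -> h.1 = k.1 -> h = k.
Proof.
move=> r /same_edge[//|E]; move: (hroot_neq_hend h).
by rewrite r E eqxx.
Qed.

Lemma far_disjoint h k v :
  hroot h = hroot k -> h != k -> v \in far h -> v \notin far k.
Proof.
move=> r hk; rewrite -far_hopp; move: v; apply: far_elim.
  rewrite -[_ \in _]/(_ \in far (hopp k)); apply: far_step => /=.
    by rewrite r -hend_hopp; apply: hend_far.
  by apply: contraNneq hk => /(no_loop r) ->.
move=> k' kk' k'h k'k; apply: far_step => //=.
apply: contraNneq (hroot_far h) => e; rewrite r.
case: (same_edge e) => E; last by rewrite E; apply: far_step.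
by move: k'h; rewrite E.
Qed.

Lemma far_cover w v : v != w -> exists2 k, hroot k = w & v \in far k.
Proof.
suff: v = w \/ exists2 k, hroot k = w & v \in far k.
  by case=> [->|//]; rewrite eqxx.
move: v (tree_connect w v); apply: connect_elim; first by left.
move=> h _ _ [rh|[k rk hk]].
  by right; exists h => //; apply: hend_far.
case: (eqVneq h.1 k.1) => [hk1|hk1]; last first.
  by right; exists k => //; apply: far_step.
case: (same_edge (esym hk1)) => E; last by left; rewrite E hend_hopp.
by move: hk; rewrite E (negbTE (hroot_far _)).
Qed.

Definition onward h k := (hroot k == hend h) && (k != hopp h).

Lemma onward_far h k : onward h k -> {subset far k <= far h}.
Proof.
move=> /andP[/eqP r kh] v vk; rewrite -[h]hoppK far_hopp.
by apply: far_disjoint vk => //; rewrite r.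
Qed.

Lemma onward_card h k : onward h k -> (#|far k| < #|far h|)%N.
Proof.
move=> hk; apply/proper_card/properP; split.
  exact/fintype.subsetP/onward_far.
exists (hend h); first exact: hend_far.
by move: hk => /andP[/eqP<- _]; apply: hroot_far.
Qed.

Lemma far_ind (P : halfedge T -> Prop) :
  (forall h, (forall k, onward h k -> P k) -> P h) -> forall h, P h.
Proof.
move=> st h; move: {2}#|far h|.+1 (ltnSn #|far h|) => n.
elim: n h => // n IH h hn; apply: st => k hk; apply: IH.
by apply: leq_trans (onward_card hk) _.
Qed.

Lemma far_onward h v : v \in far h ->
  v = hend h \/ exists2 k, onward h k & v \in far k.
Proof.
move=> vh; case: (eqVneq v (hend h)) => [|ne]; first by left.
have [k rk vk] := far_cover ne; right; exists k => //.
rewrite /onward rk eqxx /=; apply: contraTneq vk => ->.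
by rewrite far_hopp vh.
Qed.

Lemma sum_hroot (M : nmodType) h (F : halfedge T -> M) :
  (\sum_(k | hroot k == hend h) F k = F (hopp h) + \sum_(k | onward h k) F k)%R.
Proof. by rewrite (bigD1 (hopp h)) /= ?eqxx //. Qed.

Lemma far_indicator h v :
  (v \in far h : nat) = ((v == hend h) + \sum_(k | onward h k) (v \in far k))%N.
Proof.
have zero k : onward h k -> v \notin far h -> (v \in far k) = false.
  by move=> hk; apply: contraNF; apply: onward_far.
case: (boolP (v \in far h)) => vh; last first.
  rewrite big1 => [|k hk]; last by rewrite zero.
  by case: eqP vh => // ->; rewrite hend_far.
have [->|[k hk vk]] := far_onward vh.
  rewrite eqxx big1 // => k /andP[/eqP <- _].
  by rewrite (negbTE (hroot_far k)).
have [/eqP rk _] := andP hk.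
rewrite (bigD1 k) //= vk big1 => [|k' /andP[/andP[/eqP rk' _] kk']]; last first.
  by apply/eqP; rewrite eqb0; apply: far_disjoint vk; rewrite ?rk // eq_sym.
by case: eqP vk => // ->; rewrite -rk (negbTE (hroot_far k)).
Qed.

End Trees.

(** * Riemann-Hurwitz over the tree *)

Section Covers.
Variables (R : realType) (X : weighted_cover R).
Local Notation G := (Gam X).
Local Notation T := (Tree X).
Implicit Types (h k : halfedge T) (v : gV G) (w : gV T).
Local Open Scope ring_scope.

Definition phiH (h : halfedge G) : halfedge T := (phiE h.1, h.2).

Lemma hroot_phiH (h : halfedge G) : hroot (phiH h) = phiV (hroot h).
Proof. by case: h => e []; rewrite /hroot /= ?phi_src ?phi_tgt. Qed.

Lemma hend_phiH (h : halfedge G) : hend (phiH h) = phiV (hend h).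
Proof. by rewrite /hend -hroot_phiH. Qed.

Definition branches h : nat := #|[pred i | phiV (ram_pt X i) \in far h]|.

Lemma branches_onward h :
  branches h = (branch_at (inl (hend h)) + \sum_(k | onward h k) branches k)%N.
Proof.
have count (P : pred 'I_6) : #|[pred i | P i]| = (\sum_i (P i : nat))%N.
  by rewrite -sum1_card big_mkcond; apply: eq_bigr => i _; rewrite inE; case: (P i).
rewrite {1}/branches /= !count.
rewrite (eq_bigr (fun k => \sum_i (phiV (ram_pt X i) \in far k)))%N; last first.
  by move=> k _; rewrite -count.
rewrite exchange_big -big_split /=; apply: eq_bigr => i _.
exact: (far_indicator (Tree_genus0 X)).
Qed.

Lemma leq_branches h k : onward h k -> (branches k <= branches h)%N.
Proof. by move=> hk; rewrite (branches_onward h) (bigD1 k) //= addnCA leq_addr. Qed.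

Definition sheets (e' : gE T) : nat := #|[pred e : gE G | phiE e == e']|.

Lemma sum_phiH (M : nmodType) k (F : gE G -> M) :
  \sum_(h : halfedge G | phiH h == k) F h.1 = \sum_(e | phiE e == k.1) F e.
Proof.
rewrite (reindex_onto (fun e => (e, k.2)) fst) /=.
  by apply: eq_bigl => e; case: k => e' b; rewrite xpair_eqE !eqxx !andbT.
by case=> e b /eqP <-.
Qed.

Lemma sum_expansion (e' : gE T) : (\sum_(e | phiE e == e') expansion e = 2)%N.
Proof.
have := sum_phiH (M := nat) (e', false) (@expansion R X); rewrite /= => <-.
rewrite (partition_big (@hroot G) (fun v => phiV v == src e')) /=; last first.
  by move=> h /eqP hE; rewrite -hroot_phiH hE.
rewrite -(degree2 (src e')); apply: eq_bigr => v /eqP pv.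
rewrite -(harmonic (h' := (e', false)) (esym pv)).
by apply: eq_bigl => h; rewrite andbC /phiH xpair_eqE.
Qed.

Lemma expansion_gt0 (e : gE G) : (0 < expansion e <= 2)%N.
Proof. by case/orP: (expansion12 e) => /eqP->. Qed.

Lemma sum_ramification (e' : gE T) :
  \sum_(e | phiE e == e') ((expansion e)%:Z - 1) = 2 - (sheets e')%:Z.
Proof.
rewrite sumrB -(big_morph Posz PoszD (erefl _)) sum_expansion.
by rewrite sumr_const natz.
Qed.

Lemma sheets_bounds (e' : gE T) : (1 <= sheets e' <= 2)%N.
Proof.
apply/andP; split; last first.
  rewrite -(sum_expansion e') /sheets -sum1_card; apply: leq_sum => e _.
  by case/andP: (expansion_gt0 e).
rewrite lt0n; apply/eqP => s0; have := sum_expansion e'.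
rewrite big_pred0 // => e; apply/negbTE/negP => pe.
by have /card0_eq/(_ e) := s0; rewrite inE pe.
Qed.

Lemma fiber_riemann_hurwitz w :
  \sum_(v | phiV v == w) (2 * (genus v)%:Z - 2) =
  - 4 + (branch_at (inl w : mpoint T))%:Z
    + \sum_(k | hroot k == w) (2 - (sheets k.1)%:Z).
Proof.
under eq_bigr => v /eqP pv.
  rewrite riemann_hurwitz (tree_genus (Tree_genus0 X)) /= mulr0 add0r; over.
rewrite [LHS]big_split [X in X + _ = _]big_split /=; congr (_ + _ + _).
- by rewrite -mulr_suml -(big_morph Posz PoszD (erefl _)) degree2.
- rewrite -(big_morph Posz PoszD (erefl _)) /=; congr Posz.
  rewrite -!sum1_card.
  rewrite (partition_big (@ram_pt R X) (fun v => phiV v == w)) //=.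
  apply: eq_bigr => v /eqP pv; rewrite -sum1_card; apply: eq_bigl => i.
  by rewrite !unfold_in; case: eqP => [->|]; rewrite ?pv ?eqxx ?andbF.
rewrite [LHS](_ : _ = \sum_(h : halfedge G | phiV (hroot h) == w)
   ((expansion h.1)%:Z - 1)); last first.
  rewrite (partition_big (@hroot G) (fun v => phiV v == w)) //=.
  apply: eq_bigr => v /eqP pv; apply: eq_bigl => h.
  by case: eqP => [->|]; rewrite ?pv ?eqxx ?andbF.
rewrite (partition_big phiH (fun k => hroot k == w)) /=; last first.
  by move=> h; rewrite hroot_phiH.
apply: eq_bigr => k /eqP rk; rewrite -sum_ramification -sum_phiH.
apply: eq_bigl => h.
by case: (phiH h =P k) => [E|]; rewrite ?andbF // -hroot_phiH E rk eqxx.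
Qed.

Lemma sheets_parity k : odd (sheets k.1) = odd (branches k).
Proof.
elim/(far_ind (Tree_genus0 X)): k => h IH.
have := fiber_riemann_hurwitz (hend h); rewrite sum_hroot /=.
have -> : \sum_(v | phiV v == hend h) (2 * (genus v)%:Z - 2) =
   2 * \sum_(v | phiV v == hend h) ((genus v)%:Z - 1).
  by rewrite mulr_sumr; apply: eq_bigr => v _; rewrite mulrBr mulr1.
have : exists z : int, \sum_(k | onward h k) (2 - (sheets k.1)%:Z) =
   (\sum_(k | onward h k) branches k)%N%:Z + 2 * z.
  rewrite (big_morph Posz PoszD (erefl _)).
  elim/big_ind2: _ => [|x1 x2 y1 y2 [z ->] [z' ->]|k hk].
  - by exists 0.
  - by exists (z + z'); ring.
  - have := IH k hk; have := sheets_bounds k.1 => b par.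
    by exists (1 - (sheets k.1 + branches k)./2%:Z); lia.
move=> [z ->]; rewrite (branches_onward h) /=; lia.
Qed.

Lemma few_branches h v : (branches h <= 1)%N -> phiV v = hend h ->
  genus v = 0%N /\
  (#|[pred k : halfedge G | (hroot k == v) && (phiH k == hopp h)]| <= 1)%N.
Proof.
move=> b1 pv; have := fiber_riemann_hurwitz (hend h); rewrite sum_hroot /=.
have onward1 : \sum_(k | onward h k) (2 - (sheets k.1)%:Z) =
    (\sum_(k | onward h k) branches k)%N%:Z.
  rewrite (big_morph Posz PoszD (erefl _)); apply: eq_bigr => k hk.
  have := leq_branches hk; have := sheets_parity k; have := sheets_bounds k.1.
  by lia.
rewrite onward1; have := sheets_parity h; have := sheets_bounds h.1.
move: b1; rewrite (branches_onward h) /=.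
pose ends u := #|[pred k : halfedge G | (hroot k == u) && (phiH k == hopp h)]|.
have ends_gt0 u : phiV u = hend h -> (0 < ends u)%N.
  move=> pu; rewrite lt0n; apply/eqP => /card0_eq none.
  have := degree_gt0 u; rewrite -(harmonic (h' := hopp h) (esym pu)) big_pred0 //.
have sum_ends : (\sum_(u | phiV u == hend h) ends u = sheets h.1)%N.
  rewrite /sheets -sum1_card -(sum_phiH (hopp h) (fun=> 1%N)).
  rewrite [RHS](partition_big (@hroot G) (fun u => phiV u == hend h)) /=; last first.
    by move=> k /eqP E; rewrite -hroot_phiH E.
  apply: eq_bigr => u _; rewrite /ends -sum1_card; apply: eq_bigl => k.
  by rewrite inE andbC.
have -> : \sum_(u | phiV u == hend h) (2 * (genus u)%:Z - 2) =
   2 * (\sum_(u | phiV u == hend h) genus u)%N%:Z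
     - 2 * (\sum_(u | phiV u == hend h) 1)%N%:Z.
  rewrite !(big_morph Posz PoszD (erefl _)) !mulr_sumr -sumrB.
  by apply: eq_bigr => u _; rewrite mulr1.
rewrite -sum_ends => b1 bds par eqn.
have : (\sum_(u | phiV u == hend h) (genus u + ends u) =
        \sum_(u | phiV u == hend h) 1)%N.
  by rewrite big_split /=; lia.
rewrite (bigD1 v) ?pv //= [RHS](bigD1 v) ?pv //=.
have : (\sum_(u | (phiV u == hend h) && (u != v)) 1 <=
        \sum_(u | (phiV u == hend h) && (u != v)) (genus u + ends u))%N.
  by apply: leq_sum => u /andP[/eqP pu _]; apply: ltn_addl; apply: ends_gt0.
rewrite -/(ends v) => le eq_s; have := ends_gt0 v pv.
by move: (ends v) (\sum_(u | _ && _) 1)%N (\sum_(u | _ && _) (_ + _))%N le eq_s; lia.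
Qed.

End Covers.

(** * Leaves of subcurves *)

Section RemoveLeaf.
Variable G : graph.
Implicit Types (h k : halfedge G) (u v w : gV G).
Variables (A : {set gV G}) (B : {set gE G}).

Definition val_in u : nat := #|[pred h : halfedge G | (h.1 \in B) && (hroot h == u)]|.

Lemma remove_leaf (n : nat) u :
  connected_of_genus A B n.+1 -> u \in A -> genus u = 0%N ->
  (val_in u <= 1)%N ->
  connected_of_genus (A :\ u)%SET
    [set e in B | (src e != u) && (tgt e != u)]%SET n.+1.
Proof.
move=> [sub [_ conn] gen] uA gu val1.
have ends h : h.1 \in B -> hroot h \in A.
  by move=> /sub /andP[sA tA]; rewrite /hroot; case: ifP.
have [h [hB rh]] : exists h, h.1 \in B /\ hroot h = u.
  case: (pickP [pred h : halfedge G | (h.1 \in B) && (hroot h == u)]).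
    by move=> h /andP[hB /eqP rh]; exists h.
  move=> none.
  have Au : A = [set u]%SET.
    apply/setP => v; rewrite inE; apply/idP/eqP => [vA|->//].
    move: (conn u v uA vA) => {vA}; move: v; apply: connect_elim => // h hB _ rh.
    by have := none h; rewrite /= hB rh eqxx.
  have B0 : B = finset.set0.
    apply/setP => e; rewrite inE; apply/negP => eB.
    have := ends (e, false) eB; rewrite Au inE => /eqP r.
    by have := none (e, false); rewrite /= eB r eqxx.
  by move: gen; rewrite /arith_genus /betti1 B0 Au cards0 cards1 big_set1 gu.
have only_h k : k.1 \in B -> hroot k = u -> k = h.
  move=> kB rk; apply/eqP; apply: contraTT val1 => kh.
  rewrite -ltnNge /val_in (cardD1 h) (cardD1 k) !inE hB kB rh rk eqxx kh /=.
  by rewrite !add1n.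
have hu : hend h != u.
  apply/eqP => e; have := hopp_neq h.
  by rewrite (only_h (hopp h)) ?eqxx.
have B'E e : (e \in [set e in B | (src e != u) && (tgt e != u)]%SET) =
    (e \in B) && (e != h.1).
  rewrite inE; case eB : (e \in B) => //=.
  apply/idP/idP => [/andP[su tu]|eh].
    apply/eqP => eh; move: su tu; rewrite -rh /hroot eh.
    by case: (h.2); rewrite eqxx ?andbF.
  apply/andP; split; apply: contraNneq eh => E.
    by rewrite -(only_h (e, false)).
  by rewrite -(only_h (e, true)).
split.
- move=> e; rewrite !inE => /andP[/sub/andP[sA tA] /andP[su tu]].
  by rewrite su tu sA tA.
- split; first by exists (hend h); rewrite !inE hu ends.
  move=> v w; rewrite !inE => /andP[vu vA] /andP[wu wA].
  (* Contracting the leaf edge maps paths of B to paths avoiding the leaf. *)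
  pose r x := if x == u then hend h else x.
  have -> : v = r v by rewrite /r (negbTE vu).
  have -> : w = r w by rewrite /r (negbTE wu).
  move: (conn v w vA wA) => {wu wA}; move: w; apply: connect_elim => // k kB _.
  move=> /connect_trans -> //.
  case: (eqVneq k h) => [->|kh].
    by rewrite /r rh eqxx (negbTE hu).
  have rk : hroot k != u by apply: contra_neq kh; apply: only_h.
  case: (eqVneq (hend k) u) => [ek|ek].
    have E : hopp k = h by apply: only_h.
    by rewrite /r ek eqxx (negbTE rk) -E hend_hopp.
  rewrite /r (negbTE rk) (negbTE ek); apply: connect_adj.
  rewrite B'E kB /=; apply: contra_neq kh => /esym/same_edge[//|E].
  by move: ek; rewrite E hend_hopp rh eqxx.
- have -> : [set e in B | (src e != u) && (tgt e != u)]%SET = (B :\ h.1)%SET.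
    by apply/setP => e; rewrite B'E !inE andbC.
  move: gen; rewrite /arith_genus /betti1.
  rewrite (big_setD1 u uA) /= gu (cardsD1 u A) (cardsD1 h.1 B) uA hB /=.
  by move: (\sum_(i in _) _)%R => s; lia.
Qed.

End RemoveLeaf.

Section Points.
Variables (R : realType) (G : mgraph R).
Implicit Types (e : gE G) (t : R).
Local Open Scope ring_scope.

Lemma epoint_interior e t (H : 0 < t < len e) :
  epoint e t = inr (exist (fun x : gE G * R => 0 < x.2 < len x.1) (e, t) H).
Proof.
rewrite /epoint; case: insubP => [x _ E|]; last by rewrite H.
by congr inr; apply: val_inj.
Qed.

Lemma epoint_src e t : t <= 0 -> epoint e t = inl (src e).
Proof.
move=> t0; rewrite /epoint; case: insubP => [x /=|_]; last by rewrite t0.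
by rewrite ltNge t0.
Qed.

Lemma epoint_tgt e t : len e <= t -> epoint e t = inl (tgt e).
Proof.
move=> te; have t0 : 0 < t by apply: lt_le_trans te; apply: len_gt0.
rewrite /epoint; case: insubP => [x /=|_]; last by rewrite leNgt t0.
by rewrite [t < _]ltNge te andbF.
Qed.

Lemma epoint_inj e e' t t' : 0 < t < len e -> epoint e t = epoint e' t' ->
  e' = e /\ t' = t.
Proof.
move=> H; rewrite (epoint_interior H).
case: (boolP (0 < t' < len e')) => [H'|].
  by rewrite (epoint_interior H') => -[-> ->].
rewrite negb_and -!leNgt => /orP[t0|tl]; first by rewrite epoint_src.
by rewrite epoint_tgt.
Qed.

Variable c : gE G -> seq R.
Hypothesis vc : valid_cuts c.

Lemma breakpoint_lt e (i j : nat) : (i < j)%N -> (j <= (size (c e)).+1)%N ->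
  breakpoint c e i < breakpoint c e j.
Proof.
move=> ij js; apply: (sorted_ltn_nth lt_trans) => //.
- exact: vc.
- by rewrite inE /= size_rcons ltnS; apply: leq_trans js; apply: ltnW.
- by rewrite inE /= size_rcons ltnS.
Qed.

Lemma breakpoint_le e (i j : nat) : (i <= j)%N -> (j <= (size (c e)).+1)%N ->
  breakpoint c e i <= breakpoint c e j.
Proof.
by rewrite leq_eqVlt => /orP[/eqP->//|ij js]; apply/ltW/breakpoint_lt.
Qed.

Lemma breakpoint_lt_inv e (i j : nat) : (i <= (size (c e)).+1)%N ->
  breakpoint c e i < breakpoint c e j -> (i < j)%N.
Proof.
move=> js; rewrite ltnNge; apply: contraTN => ij; rewrite -leNgt.
exact: breakpoint_le.
Qed.

Lemma breakpoint0 e : breakpoint c e 0 = 0. Proof. by []. Qed.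

Lemma breakpoint_last e : breakpoint c e (size (c e)).+1 = len e.
Proof. by rewrite /breakpoint /= nth_rcons ltnn eqxx. Qed.

Lemma breakpoint_cut e (i : nat) : (i < size (c e))%N ->
  nth 0 (c e) i = breakpoint c e i.+1.
Proof. by move=> iS; rewrite /breakpoint /= nth_rcons iS. Qed.

Lemma breakpoint_interior e (i : nat) : (0 < i <= size (c e))%N ->
  0 < breakpoint c e i < len e.
Proof.
move=> /andP[i0 iS]; rewrite -(breakpoint0 e) -breakpoint_last.
by rewrite !breakpoint_lt // leqW.
Qed.

Lemma tagged_ord_eq (n : gE G -> nat) (p q : {e : gE G & 'I_(n e)}) :
  tag p = tag q -> (tagged p = tagged q :> nat) -> p = q.
Proof.
by case: p q => e i [e' j] /= E; case: _ / E j => j /val_inj ->.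
Qed.

Lemma subd_srcP (x : subdE c) :
  (tagged x = 0 :> nat /\ subd_src x = inl (src (tag x)))
  \/ exists p : {e : gE G & 'I_(size (c e))},
        [/\ tag p = tag x, tagged x = (tagged p).+1 :> nat &
            subd_src x = inr p].
Proof.
case: x => e j; rewrite /subd_src /=; case: unliftP => [i ->|->]; last by left.
by right; exists (existT _ e i).
Qed.

Lemma subd_tgtP (x : subdE c) :
  (tagged x = size (c (tag x)) :> nat /\ subd_tgt x = inl (tgt (tag x)))
  \/ exists p : {e : gE G & 'I_(size (c e))},
        [/\ tag p = tag x, tagged x = tagged p :> nat &
            subd_tgt x = inr p].
Proof.
case: x => e j; rewrite /subd_tgt /=; case: unliftP => [i ->|->]; last by left.
by right; exists (existT _ e i); split=> //=; rewrite /bump leqNgt ltn_ord.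
Qed.

Lemma vertex_point_cut (p : {e : gE G & 'I_(size (c e))}) e : tag p = e ->
  vertex_point (inr p : gV (subdivision c)) =
  epoint e (breakpoint c e (tagged p).+1).
Proof. by move=> <-; rewrite /= breakpoint_cut. Qed.

Lemma vertex_point_src (x : subdE c) :
  vertex_point (subd_src x : gV (subdivision c)) =
  epoint (tag x) (breakpoint c (tag x) (tagged x)).
Proof.
case: (subd_srcP x) => [[-> ->]|[p [px -> ->]]]; last exact: vertex_point_cut.
by rewrite epoint_src.
Qed.

Lemma vertex_point_tgt (x : subdE c) :
  vertex_point (subd_tgt x : gV (subdivision c)) =
  epoint (tag x) (breakpoint c (tag x) (tagged x).+1).
Proof.
case: (subd_tgtP x) => [[-> ->]|[p [px -> ->]]]; last exact: vertex_point_cut.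
by rewrite breakpoint_last epoint_tgt.
Qed.

Lemma vertex_point_eq_cut (u : gV (subdivision c)) e t : 0 < t < len e ->
  vertex_point u = epoint e t ->
  exists p : {e : gE G & 'I_(size (c e))},
    [/\ u = inr p, tag p = e & breakpoint c e (tagged p).+1 = t].
Proof.
case: u => [v|q] H; first by rewrite (epoint_interior H).
rewrite (vertex_point_cut (erefl _)) => /esym /(epoint_inj H)[qe <-].
by exists q; rewrite -qe.
Qed.

Lemma cut_interior (p : {e : gE G & 'I_(size (c e))}) :
  0 < breakpoint c (tag p) (tagged p).+1 < len (tag p).
Proof. by apply: breakpoint_interior; exact: ltn_ord. Qed.

Lemma vertex_point_inj : injective (@vertex_point R G c).
Proof.
move=> u [v|p].
  case: u => [w|q]; first by case=> ->.
  rewrite (vertex_point_cut (erefl _)).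
  by rewrite (epoint_interior (cut_interior q)).
rewrite (vertex_point_cut (erefl _)) => /(vertex_point_eq_cut (cut_interior p)).
move=> [q [-> qp E]]; congr inr; apply: tagged_ord_eq => //.
have qS : (tagged q < size (c (tag p)))%N by rewrite -qp.
case: (ltngtP (tagged q) (tagged p)) => // lt.
  have := @breakpoint_lt (tag p) (tagged q).+1 (tagged p).+1 lt.
  by rewrite E ltxx => /(_ (leqW (ltn_ord _))).
have := @breakpoint_lt (tag p) (tagged p).+1 (tagged q).+1 lt.
by rewrite E ltxx => /(_ (leqW qS)).
Qed.

Lemma vertex_on_piece (u : gV (subdivision c)) (x : gE (subdivision c)) t :
  breakpoint c (tag x) (tagged x) <= t <= breakpoint c (tag x) (tagged x).+1 ->
  vertex_point u = epoint (tag x) t -> u = src x \/ u = tgt x.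
Proof.
move=> /andP[]; rewrite le_eqVlt => /orP[/eqP <- _|lo].
  by rewrite -vertex_point_src => /vertex_point_inj ->; left.
rewrite le_eqVlt => /orP[/eqP ->|hi].
  by rewrite -vertex_point_tgt => /vertex_point_inj ->; right.
have H : 0 < t < len (tag x).
  rewrite (le_lt_trans _ lo) ?(lt_le_trans hi) //.
    by rewrite -(breakpoint_last (tag x)) breakpoint_le.
  by rewrite -(breakpoint0 (tag x)) breakpoint_le // leqW // -ltnS.
move=> E; have [p [_ pe pt]] := vertex_point_eq_cut H E.
have pS : (tagged p < size (c (tag x)))%N by rewrite -pe.
have xS : (tagged x <= size (c (tag x)))%N by rewrite -ltnS.
have := breakpoint_lt_inv (e := tag x) (i := tagged x) (j := (tagged p).+1).
have := breakpoint_lt_inv (e := tag x) (i := (tagged p).+1) (j := (tagged x).+1).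
by rewrite pt => /(_ _ hi) + /(_ _ lo); lia.
Qed.

Definition rationally_leafless (A : {set gV (subdivision c)})
  (B : {set gE (subdivision c)}) : Prop :=
  is_subgraph A B /\
  forall u, u \in A -> genus u = 0%N -> (2 <= val_in B u)%N.

(* A leaf of genus 0 could be removed. *)
Lemma core_no_leaf (A : {set gV (subdivision c)}) (B : {set gE (subdivision c)}) :
  connected_of_genus A B 2 -> is_core (realization A B) -> rationally_leafless A B.
Proof.
move=> gAB [_ _ minimal]; split=> [|u uA gu]; first by case: gAB.
rewrite leqNgt; apply/negP; rewrite ltnS => val1.
have gAB' := remove_leaf gAB uA gu val1.
set A' := (A :\ u)%SET in gAB'; set B' := [set e in B | _]%SET in gAB'.
have eqR : realization A' B' = realization A B.
  apply: minimal => //; first by exists c => //; exists A', B'.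
  move=> p [[w wA ->]|[x xB [t tx ->]]].
    by left; exists w => //; move: wA; rewrite inE => /andP[].
  by right; exists x; [by move: xB; rewrite inE => /andP[] | exists t].
have : realization A B (vertex_point u) by left; exists u.
rewrite -eqR => -[[w wA /vertex_point_inj uw]|[x xB [t tx E]]].
  by move: wA; rewrite -uw !inE eqxx.
move: xB; rewrite inE => /andP[_ /andP[]].
by case: (vertex_on_piece tx E) => <-; rewrite eqxx.
Qed.

End Points.

Section Chains.
Variables (R : realType) (G : mgraph R) (c : gE G -> seq R).
Variables (A : {set gV (subdivision c)}) (B : {set gE (subdivision c)}).
Hypothesis coreAB : rationally_leafless A B.
Implicit Types (e : gE G) (p : {e : gE G & 'I_(size (c e))}).

Lemma piece_end (h : halfedge (subdivision c)) : h.1 \in B -> hend h \in A.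
Proof.
case: coreAB h => sub _ [x b] /= /sub /andP[sA tA].
by rewrite /hend /hroot /=; case: b.
Qed.

Lemma hroot_cut (h : halfedge (subdivision c)) p : hroot h = inr p ->
  tag h.1 = tag p /\ (tagged h.1 = tagged p + ~~ h.2 :> nat)%N.
Proof.
case: h => x [] /=; rewrite /hroot /=.
  by case: (subd_tgtP x) => [[_ ->]//|[q [xq -> -> [<-]]]]; rewrite addn0.
by case: (subd_srcP x) => [[_ ->]//|[q [xq -> -> [<-]]]]; rewrite addn1.
Qed.

Lemma hroot_vertex (h : halfedge (subdivision c)) (v : gV G) : hroot h = inl v ->
  hroot ((tag h.1, h.2) : halfedge G) = v /\
  (tagged h.1 = (if h.2 then size (c (tag h.1)) else 0) :> nat)%N.
Proof.
case: h => x [] /=; rewrite /hroot /=.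
  by case: (subd_tgtP x) => [[-> ->] [->]|[q [_ _ ->]]].
by case: (subd_srcP x) => [[-> ->] [->]|[q [_ _ ->]]].
Qed.

Lemma hend_piece (h : halfedge (subdivision c)) :
  hend h = inl (hend ((tag h.1, h.2) : halfedge G)) \/
  exists2 p : {e : gE G & 'I_(size (c e))}, tag p = tag h.1 & hend h = inr p.
Proof.
case: h => x []; rewrite /hend /hroot /=.
  by case: (subd_srcP x) => [[_ ->]|[q [xq _ ->]]]; [left|right; exists q].
by case: (subd_tgtP x) => [[_ ->]|[q [xq _ ->]]]; [left|right; exists q].
Qed.

(* The vertices on the open edge of h form a chain: if its end is not in the
   subgraph, the last vertex of the chain lying in it would be a leaf. *)
Lemma cuts_notin (h : halfedge G) : inl (hend h) \notin A ->
  forall p : {e : gE G & 'I_(size (c e))}, tag p = h.1 -> inr p \notin A.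
Proof.
case: h => e b eA p.
pose dist (q : {e : gE G & 'I_(size (c e))}) :=
  if b then tagged q : nat else (size (c e) - tagged q)%N.
move: {2}(dist p).+1 (ltnSn (dist p)) => n.
elim: n p => // n IH p; rewrite ltnS => pn /= pe.
apply/negP => pA; case: coreAB => _ /(_ _ pA erefl); rewrite leqNgt => /negP; apply.
have back (k : halfedge (subdivision c)) :
    k.1 \in B -> hroot k = inr p -> k.2 = ~~ b.
  move=> kB rk; have := piece_end kB; have [kp kt] := hroot_cut rk.
  case: (eqVneq k.2 b) => [kb|]; last by case: (k.2) (b) => [] [].
  have [->|[q qk kq]] := hend_piece k.
    by rewrite kp kb pe (negbTE eA).
  have [_ /=] := hroot_cut (h := hopp k) kq; rewrite kt kb => pq.
  have qe : tag q = e by rewrite qk kp.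
  rewrite kq; apply: contraTeq => _; apply: IH => //.
  apply: leq_trans pn; rewrite /dist.
  have pS : (tagged p < size (c e))%N by rewrite -pe.
  by case: (b) pq => /=; lia.
rewrite ltnS; apply/card_le1_eqP => k k'; rewrite !inE.
move=> /andP[kB /eqP rk] /andP[kB' /eqP rk'].
have [kp kt] := hroot_cut rk; have [kp' kt'] := hroot_cut rk'.
have kk : k.2 = k'.2 by rewrite !back.
rewrite [k]surjective_pairing [k']surjective_pairing kk; congr pair.
by apply: tagged_ord_eq; rewrite ?kp ?kp' // kt kt' kk.
Qed.

End Chains.

Section FewBranches.
Variables (R : realType) (X : weighted_cover R).
Local Notation G := (Gam X).
Local Notation T := (Tree X).
Variables (c : gE G -> seq R).
Variables (A : {set gV (subdivision c)}) (B : {set gE (subdivision c)}).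
Hypothesis coreAB : rationally_leafless A B.

Lemma notin_far (k : halfedge T) : (branches k <= 1)%N ->
  (forall v : gV G, phiV v \in far k -> inl v \notin A) /\
  (forall (h : halfedge G) (p : {e : gE G & 'I_(size (c e))}),
     tag p = h.1 -> phiV (hend h) \in far k -> inr p \notin A).
Proof.
elim/(far_ind (Tree_genus0 X)): k => k IH bk.
have {}IH k' (kk : onward k k') := IH k' kk (leq_trans (leq_branches kk) bk).
have at_end v : phiV v = hend k -> inl v \notin A.
  move=> pv; have [gv few] := few_branches bk pv.
  apply/negP => vA; case: coreAB => _ /(_ _ vA gv).
  rewrite leqNgt ltnS => /negP; apply.
  have back (h : halfedge (subdivision c)) : h.1 \in B -> hroot h = inl v ->
      phiH ((tag h.1, h.2) : halfedge G) = hopp k.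
    move=> hB /hroot_vertex[rh _]; apply/eqP; apply: contraTT (piece_end coreAB hB).
    move=> ne; have kk : onward k (phiH ((tag h.1, h.2) : halfedge G)).
      by rewrite /onward ne hroot_phiH rh pv eqxx.
    have [notV notE] := IH _ kk.
    have [->|[p ph ->]] := hend_piece h.
      by apply: notV; rewrite -hend_phiH; apply: hend_far.
    by apply: (notE (tag h.1, h.2)) => //; rewrite -hend_phiH; apply: hend_far.
  apply/card_le1_eqP => h h'; rewrite !inE => /andP[hB /eqP rh] /andP[hB' /eqP rh'].
  have [vh th] := hroot_vertex rh; have [vh' th'] := hroot_vertex rh'.
  have := (card_le1_eqP few) (tag h.1, h.2) (tag h'.1, h'.2).
  rewrite !inE vh vh' !back // !eqxx => /(_ isT isT)[t12 h12].
  rewrite [h]surjective_pairing [h']surjective_pairing h12; congr pair.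
  by apply: tagged_ord_eq => //; rewrite th th' h12 t12.
split.
  move=> v /(far_onward (Tree_genus0 X))[|[k' kk vk]]; first exact: at_end.
  by case: (IH _ kk) => + _; apply.
move=> h p ph /(far_onward (Tree_genus0 X))[eh|[k' kk hk]]; last first.
  by case: (IH _ kk) => _; apply; eauto.
case: (eqVneq (phiH (hopp h)) (hopp k)) => [E|ne].
  by apply: (cuts_notin coreAB _ (h := h)) => //; apply: at_end.
have kk : onward k (phiH (hopp h)).
  by rewrite /onward ne hroot_phiH andbT; apply/eqP.
have [_ notE] := IH _ kk.
by apply: (notE (hopp h)) => //; rewrite -hend_phiH; apply: hend_far.
Qed.

End FewBranches.

Local Open Scope classical_set_scope.
Local Open Scope ring_scope.

(** * Piecewise linear functions along edges *)

Section Travel.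
Variables (R : realType) (G : mgraph R).
Implicit Types (h : halfedge G) (p : mpoint G) (f : mpoint G -> R).

Definition hpoint h (s : R) : mpoint G :=
  epoint h.1 (if h.2 then len h.1 - s else s).

Definition hdist p h : R := if h.2 then len h.1 - Defs.coord p h else Defs.coord p h.

Lemma hpoint0 h : hpoint h 0 = inl (hroot h).
Proof.
rewrite /hpoint /hroot; case: (h.2).
  by rewrite epoint_tgt // subr0.
by rewrite epoint_src.
Qed.

Lemma hpoint_len h : hpoint h (len h.1) = inl (hend h).
Proof.
rewrite /hpoint /hend /hroot /=; case: (h.2) => /=.
  by rewrite epoint_src // subrr.
by rewrite epoint_tgt.
Qed.

Lemma hpoint_hopp h s : hpoint (hopp h) s = hpoint h (len h.1 - s).
Proof.
by rewrite /hpoint /=; case: (h.2) => //=; rewrite opprB addrC subrK.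
Qed.

Lemma travelE p h s : travel p h s = hpoint h (hdist p h + s).
Proof.
rewrite /travel /hpoint /hdist; case: (h.2) => //; congr epoint; ring.
Qed.

Lemma hpoint_hdist p h : dirs p h -> hpoint h (hdist p h) = p.
Proof.
rewrite /hpoint /hdist.
set t := Defs.coord p h.
have -> : (if h.2 then len h.1 - (if h.2 then len h.1 - t else t)
           else if h.2 then len h.1 - t else t) = t.
  by case: (h.2) => //; ring.
rewrite {}/t; case: p => [v|[[e t] H]] /= /eqP.
  by rewrite /hroot; case: (h.2) => <-; [rewrite epoint_tgt|rewrite epoint_src].
by move=> ->; exact: epoint_interior.
Qed.

Lemma hdist_bounds p h : dirs p h -> 0 <= hdist p h < len h.1.
Proof.
have := len_gt0 h.1; case: p => [v|[[e t] H]] /=; rewrite /hdist /=.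
  by move=> l0 _; case: (h.2); apply/andP; split; lra.
move=> _ /eqP->; move: H => /= /andP[t0 tl].
by case: (h.2); apply/andP; split; lra.
Qed.

Lemma hdist_inl h : hdist (inl (hroot h)) h = 0.
Proof. by rewrite /hdist /=; case: (h.2) => //; rewrite subrr. Qed.

Lemma is_slope_uniq f p h m m' : is_slope f p h m -> is_slope f p h m' -> m = m'.
Proof.
move=> [e1 e10 H1] [e2 e20 H2].
have s0 : 0 < Num.min e1 e2 by rewrite lt_min e10.
have := H1 (Num.min e1 e2); rewrite H2; last by rewrite ge_min lexx orbT ltW.
rewrite ge_min lexx (ltW s0) => /(_ isT) /addrI E.
by apply/esym/(mulIf _ E); rewrite gt_eqF.
Qed.

Lemma slopeE f p h m : is_slope f p h m -> slope f p h = m.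
Proof.
move=> H; apply: (is_slope_uniq (f := f) (p := p) (h := h)) => //.
exact: (xgetPex (P := [set m | is_slope f p h m]%classic) 0 (ex_intro _ m H)).
Qed.

Definition linear_along f h m :=
  forall s, 0 <= s <= len h.1 -> f (hpoint h s) = f (inl (hroot h)) + m * s.

Lemma linear_travel f p h m : linear_along f h m -> dirs p h ->
  forall s, 0 <= s <= len h.1 - hdist p h -> f (travel p h s) = f p + m * s.
Proof.
move=> lin ph s /andP[s0 s1]; rewrite travelE -{2}(hpoint_hdist ph).
have := hdist_bounds ph => /andP[d0 d1].
rewrite !lin; first by ring.
  by apply/andP; split; lra.
by apply/andP; split; lra.
Qed.

Lemma linear_is_slope f p h m : linear_along f h m -> dirs p h ->
  is_slope f p h m.
Proof.
move=> lin ph; exists (len h.1 - hdist p h).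
  by have /andP[_] := hdist_bounds ph; rewrite subr_gt0.
exact: linear_travel.
Qed.

Lemma linear_along_hopp f h m : linear_along f h m ->
  linear_along f (hopp h) (- m).
Proof.
move=> lin s /= /andP[s0 s1]; rewrite hpoint_hopp lin; last first.
  by apply/andP; split; lra.
have : f (inl (hroot (hopp h))) = f (inl (hroot h)) + m * len h.1.
  rewrite -/(hend h) -hpoint_len lin //.
  by rewrite lexx ltW // len_gt0.
by move=> ->; ring.
Qed.

Lemma is_PL_linear (n : nat) f : is_PL n f ->
  (forall x : edge_point G, Defs.pdiv f (inr x) = 0) ->
  forall e, exists m, forall t, 0 <= t <= len e ->
    f (epoint e t) = f (inl (src e)) + m * t.
Proof.
move=> [c vc PL] div0 e.
pose b := breakpoint c e.
have [m Hm] : exists m : nat -> R, forall k, (k <= size (c e))%N ->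
    forall t, b k <= t <= b k.+1 ->
    f (epoint e t) = f (epoint e (b k)) + m k * (t - b k).
  have /choice[m Hm] : forall k, exists m : R, (k <= size (c e))%N ->
    forall t, b k <= t <= b k.+1 ->
    f (epoint e t) = f (epoint e (b k)) + m * (t - b k).
    move=> k; case: (leqP k (size (c e))) => [kS|]; last by exists 0.
    by have [z Hz] := PL e k kS; exists (z%:~R / n%:R).
  by exists m.
have blt k : (k <= size (c e))%N -> b k < b k.+1.
  by move=> kS; apply: breakpoint_lt.
have m_eq k : (k <= size (c e))%N -> m k = m 0%N.
  elim: k => // k IH kS; rewrite -IH 1?ltnW //.
  have H : 0 < b k.+1 < len e by apply: breakpoint_interior.
  have := div0 (exist (fun x : gE G * R => 0 < x.2 < len x.1) (e, b k.+1) H).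
  rewrite /Defs.pdiv (bigD1 (e, false)) ?eqxx //= (bigD1 (e, true)) ?xpair_eqE ?eqxx //=.
  rewrite big1 ?addr0; last by move=> [e' []] /= /andP[/andP[/eqP->]]; rewrite eqxx.
  have lt1 := blt k (ltnW kS); have lt2 := blt k.+1 kS.
  rewrite (@slopeE f _ (e, false) (m k.+1)); last first.
    exists (b k.+2 - b k.+1); first by rewrite subr_gt0.
    move=> s /andP[s0 s1]; rewrite /travel /= -epoint_interior.
    rewrite (Hm k.+1 kS); last by apply/andP; split; lra.
    by ring.
  rewrite (@slopeE f _ (e, true) (- m k)); last first.
    exists (b k.+1 - b k); first by rewrite subr_gt0.
    move=> s /andP[s0 s1]; rewrite /travel /= -epoint_interior.
    rewrite (Hm k (ltnW kS) (b k.+1 - s)) 1?(Hm k (ltnW kS) (b k.+1)).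
    + by ring.
    + by apply/andP; split; lra.
    + by apply/andP; split; lra.
  by move/eqP; rewrite subr_eq0 => /eqP.
exists (m 0%N).
have upto k : (k <= (size (c e)).+1)%N -> forall t, 0 <= t <= b k ->
    f (epoint e t) = f (inl (src e)) + m 0%N * t.
  elim: k => [_ t|k IH kS t /andP[t0 tk]].
    rewrite -eq_le => /eqP <-; rewrite epoint_src //; ring.
  have bk0 : 0 <= b k by rewrite /b -(breakpoint0 c e) breakpoint_le // ltnW.
  case: (leP t (b k)) => tb; first by apply: IH; rewrite ?t0 // ltnW.
  rewrite (Hm k) //; last by rewrite (ltW tb) tk.
  by rewrite m_eq // IH ?lexx ?bk0 1?ltnW //; ring.
by move=> t tl; apply: (upto (size (c e)).+1) => //; rewrite /b breakpoint_last.
Qed.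

End Travel.

Section Admissible.
Variables (R : realType) (X : weighted_cover R).
Local Notation G := (Gam X).
Local Notation T := (Tree X).
Implicit Types (h k : halfedge T).

Definition expected_slope (v0 : gV T) h : R :=
  (branches h)%:R / 2 - 1 - (v0 \in far h)%:R.

Lemma admissible_linear v0 f : admissible_at v0 f ->
  forall h, linear_along f h (expected_slope v0 h).
Proof.
move=> [PL div_f].
have div0 (x : edge_point T) : Defs.pdiv f (inr x) = 0.
  have := div_f (inr x); rewrite /Dprime /= mul0r addr0.
  rewrite [X in X%:R](_ : _ = 2%N) ?subrr ?add0r //.
  rewrite (eq_card (B := pred2 ((val x).1, false) ((val x).1, true))).
    by rewrite card2 xpair_eqE eqxx.
  by case=> e []; rewrite !inE unfold_in /= !xpair_eqE /= ?andbT ?andbF ?orbF.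
have /choice[a lin_a] := is_PL_linear PL div0.
pose m h := if h.2 then - a h.1 else a h.1.
have lin h : linear_along f h (m h).
  have lin0 e : linear_along f (e, false) (a e) by exact: lin_a.
  case: h => e []; last exact: lin0.
  exact: linear_along_hopp (lin0 e).
have m_opp h : m (hopp h) = - m h by rewrite /m /=; case: (h.2); rewrite ?opprK.
suff mE h : m h = expected_slope v0 h by move=> h; rewrite -mE.
elim/(far_ind (Tree_genus0 X)): h => h IH.
have := div_f (inl (hend h)); rewrite /Dprime /Defs.pdiv /=.
rewrite (eq_bigr m) => [|k hk]; last exact/slopeE/linear_is_slope.
rewrite -sum1_card natr_sum.
rewrite !sum_hroot m_opp (eq_bigr _ IH) /expected_slope.
rewrite !sumrB -mulr_suml -!natr_sum.
have -> : (inl (hend h) == inl v0 :> mpoint T) = (hend h == v0) by [].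
rewrite (far_indicator (Tree_genus0 X)) (branches_onward h) /=.
rewrite !natrD eq_sym.
lra.
Qed.

End Admissible.

Section CoreBranches.
Variables (R : realType) (X : weighted_cover R).
Local Notation G := (Gam X).
Local Notation T := (Tree X).
Implicit Types (h k : halfedge T) (p y : mpoint T).

Lemma trop_epoint (e : gE G) (t : R) :
  trop (epoint e t) = epoint (phiE e) ((expansion e)%:R * t).
Proof.
have x0 : 0 < (expansion e)%:R :> R.
  by rewrite ltr0n; case/andP: (expansion_gt0 e).
case: (boolP (0 < t < len e)) => [H|].
  by rewrite (epoint_interior H).
rewrite negb_and -!leNgt => /orP[t0|tl].
  rewrite !epoint_src //=; last by rewrite pmulr_rle0.
  by rewrite phi_src.
rewrite !epoint_tgt //=; last by rewrite phi_len ler_pM2l.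
by rewrite phi_tgt.
Qed.

Lemma trop_surj y : exists x, trop x = y.
Proof.
case: y => [w|[[e' t] H]].
  case: (pickP (fun v : gV G => phiV v == w)) => [v /eqP <-|none].
    by exists (inl v).
  by have := degree2 w; rewrite big_pred0.
case: (pickP (fun e : gE G => phiE e == e')) => [e /eqP E|none].
  exists (epoint e (t / (expansion e)%:R)).
  rewrite trop_epoint mulrC divfK ?E; first exact: epoint_interior.
  by rewrite pnatr_eq0 -lt0n; case/andP: (expansion_gt0 e).
by have := sum_expansion e'; rewrite big_pred0.
Qed.

Definition beyond k y : bool :=
  match y with
  | inl w => w \in far k
  | inr x => (src (val x).1 \in far k) || (tgt (val x).1 \in far k)
  end.

Lemma beyond_hpoint k h s : 0 < s < len h.1 ->
  beyond k (hpoint h s) = (hroot h \in far k) || (hend h \in far k).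
Proof.
move=> /andP[s0 sl]; rewrite /hpoint.
have H : 0 < (if h.2 then len h.1 - s else s) < len h.1.
  by case: (h.2); apply/andP; split; lra.
rewrite (epoint_interior H) /= /hend /hroot /=.
by case: (h.2) => //=; rewrite orbC.
Qed.

Lemma beyond_trop_epoint k (e : gE G) t : 0 < t < len e ->
  beyond k (trop (epoint e t)) ->
  exists b, phiV (hend ((e, b) : halfedge G)) \in far k.
Proof.
move=> /andP[t0 tl]; have x0 : 0 < (expansion e)%:R :> R.
  by rewrite ltr0n; case/andP: (expansion_gt0 e).
rewrite trop_epoint -[epoint _ _]/(hpoint (phiE e, false) _) beyond_hpoint.
  rewrite /hend /hroot /= -phi_src -phi_tgt => /orP[]; last by exists false.
  by exists true.
by rewrite /= phi_len ltr_pM2l // mulr_gt0.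
Qed.

Lemma core_branches (Core : set (mpoint G)) x k :
  is_core Core -> Core x -> beyond k (trop x) -> (2 <= branches k)%N.
Proof.
move=> core Cx; rewrite leqNgt ltnS; apply/contraTN => bk.
have [[c vc [A [B [gAB CE]]]] _ _] := core.
rewrite CE in core Cx; have coreAB := core_no_leaf vc gAB core.
have [notV notE] := notin_far coreAB bk.
have vertex u : u \in A -> ~~ beyond k (trop (vertex_point u)).
  case: u => [v|p] uA /=; first by apply: contraL uA => /notV.
  have H := cut_interior vc p; rewrite -breakpoint_cut // in H.
  apply/negP => /(beyond_trop_epoint H)[b hb].
  by move: uA; rewrite (negbTE (notE (tag p, b) p _ hb)).
case: Cx => [[u uA ->]|[z zB [t tz ->]]]; first exact: vertex.
have [sub _] := coreAB; have /andP[sA tA] := sub _ zB.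
have onpiece (u : gV (subdivision c)) : epoint (tag z) t = vertex_point u ->
    ~~ beyond k (trop (epoint (tag z) t)).
  move=> E; rewrite E; apply: vertex.
  by case: (vertex_on_piece vc tz (esym E)) => ->.
case: (boolP (0 < t < len (tag z))) => [H|]; last first.
  rewrite negb_and -!leNgt => /orP[t0|tl].
    by apply: (onpiece (inl (src (tag z)))); rewrite epoint_src.
  by apply: (onpiece (inl (tgt (tag z)))); rewrite epoint_tgt.
apply/negP => /(beyond_trop_epoint H)[b hb].
have := piece_end coreAB (h := (z, b)) zB.
have [->|[p pz ->]] := hend_piece ((z, b) : halfedge (subdivision c)).
  by rewrite (negbTE (notV _ hb)).
by rewrite (negbTE (notE (tag z, b) p pz hb)).
Qed.
End CoreBranches.

Section Smalls.
Variable R : realType.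

Lemma small_forall (I : finType) (P : I -> R -> Prop) :
  (forall i, exists2 eps : R, 0 < eps & forall s, 0 <= s <= eps -> P i s) ->
  exists2 eps : R, 0 < eps & forall s, 0 <= s <= eps -> forall i, P i s.
Proof.
move=> H; have /choice[E HE] : forall i, exists eps : R, 0 < eps /\
    forall s, 0 <= s <= eps -> P i s.
  by move=> i; have [eps e0 Pe] := H i; exists eps.
exists (\big[Num.min/1]_i E i).
  by apply/bigmin_gtP; split=> // i _; case: (HE i).
move=> s /andP[s0 sE] i; have [_] := HE i; apply.
by rewrite s0 (le_trans sE) // bigmin_le_cond.
Qed.

Lemma small_lt (a b m m' : R) : a < b ->
  exists2 eps : R, 0 < eps & forall s, 0 <= s <= eps -> a + m * s < b + m' * s.
Proof.
move=> ab; have d0 : 0 < `|m - m'| + 1 by rewrite ltr_wpDl.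
exists ((b - a) / (`|m - m'| + 1)); first by rewrite divr_gt0 // subr_gt0.
move=> s /andP[s0]; rewrite ler_pdivlMr // => sd.
have := ler_norm (m - m'); rewrite le_eqVlt in s0; case/orP: s0 => [/eqP <-|s0].
  by rewrite !mulr0 !addr0.
rewrite -(ler_pM2l s0); nra.
Qed.

End Smalls.

(** * Ascending paths *)

Section Ascent.
Variables (R : realType) (X : weighted_cover R).
Local Notation T := (Tree X).
Implicit Types (h k : halfedge T) (p y : mpoint T).
Variables (v0 : gV T) (f : mpoint T -> R).
Hypothesis adm : admissible_at v0 f.

Lemma ascent_edge k s s' : v0 \notin far k -> (2 <= branches k)%N ->
  0 <= s -> s <= s' -> s' <= len k.1 -> f (hpoint k s) <= f (hpoint k s').
Proof.
move=> v0k bk s0 ss' s'l; have lin t b := @admissible_linear _ _ _ _ adm k t b.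
rewrite (lin s) ?s0 ?(le_trans ss') // (lin s') ?s'l ?(le_trans s0) //.
rewrite lerD2l ler_wpM2l // /expected_slope (negbTE v0k) subr0 subr_ge0.
by rewrite ler_pdivlMr // mul1r ler_nat.
Qed.

Lemma ascent_vertex h z : v0 \notin far h -> z \in far h ->
  (forall k, z \in far k -> (2 <= branches k)%N) ->
  f (inl (hend h)) <= f (inl z).
Proof.
elim/(far_ind (Tree_genus0 X)): h => h IH v0h zh bz.
have [->//|[k hk zk]] := far_onward (Tree_genus0 X) zh.
have v0k : v0 \notin far k by apply: contra v0h; apply: (onward_far (Tree_genus0 X)).
have [/eqP <- _] := andP hk.
apply: le_trans (IH k hk v0k zk bz).
rewrite -hpoint0 -hpoint_len; apply: ascent_edge; rewrite ?lexx ?bz //.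
by rewrite ltW // len_gt0.
Qed.

Definition toward p y h : Prop :=
  dirs p h /\
  [\/ exists2 s, hdist p h < s <= len h.1 & y = hpoint h s,
      exists2 z, z \in far h & y = inl z |
      exists k s, [/\ hroot k \in far h, {subset far k <= far h},
                      0 < s < len k.1 & y = hpoint k s]].

Lemma ascent p y h : toward p y h -> v0 \notin far h ->
  (forall k, beyond k y -> (2 <= branches k)%N) -> f p <= f y.
Proof.
move=> [ph way] v0h by_.
have /andP[d0 dl] := hdist_bounds ph.
have to_end : (2 <= branches h)%N -> f p <= f (inl (hend h)).
  move=> bh; rewrite -{1}(hpoint_hdist ph) -hpoint_len.
  by apply: ascent_edge => //; apply: ltW.
case: way => [[s /andP[ds sl] yE]|[z zh yE]|[k [s [rk kh /andP[s0 sl] yE]]]].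
- rewrite -{1}(hpoint_hdist ph) yE; apply: ascent_edge => //; last exact: ltW.
  apply: by_; rewrite yE; move: sl; rewrite le_eqVlt => /orP[/eqP->|sl].
    by rewrite hpoint_len /= hend_far.
  by rewrite beyond_hpoint ?hend_far ?orbT // sl (le_lt_trans d0).
- rewrite yE in by_ *; apply: le_trans (to_end (by_ h zh)) _.
  exact: ascent_vertex.
have byk k' : (hroot k \in far k') || (hend k \in far k') -> (2 <= branches k')%N.
  by move=> H; apply: by_; rewrite yE beyond_hpoint // s0.
apply: le_trans (to_end (byk h _)) _; first by rewrite rk.
apply: le_trans (ascent_vertex v0h rk _) _.
  by move=> k' kk'; apply: byk; rewrite kk'.
rewrite -hpoint0 yE; apply: ascent_edge; rewrite ?(ltW s0) ?(ltW sl) //.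
  by apply: contra v0h; apply: kh.
by apply: byk; rewrite hend_far orbT.
Qed.

End Ascent.

Section Directions.
Variables (R : realType) (X : weighted_cover R).
Local Notation T := (Tree X).
Implicit Types (h k : halfedge T) (p y : mpoint T).
Let tree := Tree_genus0 X.

Lemma edge_point_hpoint (x : edge_point T) (b : bool) :
  exists2 s, 0 < s < len (val x).1 & inr x = hpoint ((val x).1, b) s.
Proof.
case: x => [[e t] H] /=; have /andP[/= t0 tl] := H.
exists (if b then len e - t else t); first by case: b; apply/andP; split; lra.
rewrite /hpoint /=.
have -> : (if b then len e - (if b then len e - t else t)
           else if b then len e - t else t) = t by case: b => //; ring.
by rewrite (epoint_interior H).
Qed.

Lemma toward_edge p h k s : dirs p h -> hroot k \in far h -> k.1 != h.1 ->
  hroot h \notin far k -> 0 < s < len k.1 -> toward p (hpoint k s) h.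
Proof.
move=> ph rk kh nr sl; split=> //; apply: Or33; exists k, s; split=> //.
by apply: (far_sub tree) => //; apply: far_step.
Qed.

Lemma exists_toward p y : y <> p -> exists h, toward p y h.
Proof.
have away u (e : gE T) : exists b, u \notin far ((e, b) : halfedge T).
  case: (boolP (u \in far ((e, true) : halfedge T))) => [H|]; last by exists true.
  by exists false; rewrite -[(e, false)]/(hopp (e, true)) (far_hopp tree) negbK.
case: p => [u|x0].
  case: y => [z ne|x _].
    have zu : z != u by apply/eqP => zu; apply: ne; rewrite zu.
    have [h rh zh] := far_cover tree zu; exists h; split; first by rewrite /= rh.
    by apply: Or32; exists z.
  have [b ub] := away u (val x).1; set k : halfedge T := (_, b) in ub.
  have [s sl ->] := edge_point_hpoint x b; rewrite -/k.
  case: (eqVneq (hroot k) u) => [rk|ru].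
    exists k; split; first by rewrite /= rk.
    apply: Or31; exists s => //; rewrite -rk hdist_inl.
    by case/andP: sl => -> /ltW.
  have [h rh kh] := far_cover tree ru; exists h.
  apply: toward_edge => //=; rewrite ?rh //.
  apply/eqP => kh1; have [E|E] := same_edge (h := k) (k := h) kh1.
    by move: ru; rewrite -E rh eqxx.
  by move: ub; rewrite -rh E -[hroot (hopp k)]/(hend k) hend_far.
case: y => [z ne|x ne].
  have [b zb] := away z (val x0).1.
  exists (hopp ((val x0).1, b)); split; first by rewrite /=.
  by apply: Or32; exists z; rewrite ?(far_hopp tree).
case: (eqVneq (val x).1 (val x0).1) => [xx0|nexx].
  case: x x0 xx0 ne => [[e t] H] [[e0 t0] H0] /= E; case: _ / E t0 H0 => t0 H0 ne.
  have tt : t != t0.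
    by apply: contra_notN ne => /eqP E; congr inr; apply: val_inj; rewrite /= E.
  have /andP[/= ? ?] := H; have /andP[/= ? ?] := H0.
  case: (ltgtP t t0) tt => // lt _.
    exists (e, true); split; first by rewrite /= eqxx.
    apply: Or31; exists (len e - t).
      by rewrite /hdist /=; apply/andP; split; lra.
    by rewrite /hpoint /= opprB addrC subrK (epoint_interior H).
  exists (e, false); split; first by rewrite /= eqxx.
  apply: Or31; exists t; first by rewrite /hdist /= lt ltW.
  by rewrite /hpoint /= (epoint_interior H).
have [b0 sb0] : exists b0, src (val x).1 \in far ((val x0).1, b0).
  have [b sb] := away (src (val x).1) (val x0).1.
  by exists (~~ b); rewrite -[(_, _)]/(hopp ((val x0).1, b)) (far_hopp tree).
set h : halfedge T := (_, b0) in sb0.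
have tb0 : tgt (val x).1 \in far h.
  by apply: (far_step (k := ((val x).1, false))).
have [b ub] := away (hroot h) (val x).1.
have [s sl ->] := edge_point_hpoint x b.
exists h; apply: toward_edge => //=.
by rewrite /hroot /=; case: (b).
Qed.

Lemma dirs_disjoint p h k v : dirs p h -> dirs p k -> k != h -> v \in far h ->
  v \notin far k.
Proof.
case: p => [u /eqP rh /eqP rk kh|x /eqP xh /eqP xk kh].
  by apply: (far_disjoint tree); rewrite ?rh // eq_sym.
have /same_edge[E|->] : h.1 = k.1 by rewrite xh xk.
  by rewrite E eqxx in kh.
by rewrite (far_hopp tree) negbK.
Qed.

End Directions.

(** * Special points *)

Section Special.
Variables (R : realType) (X : weighted_cover R).
Local Notation G := (Gam X).
Local Notation T := (Tree X).
Implicit Types (h k : halfedge T) (p y : mpoint T).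
Variables (lam : gV T -> mpoint T -> R) (Delta : set (mpoint G)).
Hypothesis hlam : shifted_admissible_family lam.
Hypothesis hDelta : is_Delta lam Delta.
Let tree := Tree_genus0 X.

Lemma lambda_T_ge j p : lam j p <= lambda_T lam p.
Proof. exact: (le_bigmax _ (fun v0 => lam v0 p)). Qed.

Lemma lambda_T_ge0 p : 0 <= lambda_T lam p.
Proof. exact: bigmax_ge_id. Qed.

Lemma lambda_T_attained p : 0 < lambda_T lam p ->
  exists j, lam j p = lambda_T lam p.
Proof.
move=> M0; apply: contrapT => none.
suff : lambda_T lam p < lambda_T lam p by rewrite ltxx.
apply/bigmax_ltP; split=> // j _; rewrite lt_neqAle lambda_T_ge andbT.
by apply/eqP => E; apply: none; exists j.
Qed.

Lemma travel_slope p k j : dirs p k -> forall s, 0 <= s <= len k.1 - hdist p k ->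
  lam j (travel p k s) = lam j p + expected_slope j k * s.
Proof.
by move=> pk; apply: linear_travel => //; apply: admissible_linear; case: (hlam j).
Qed.

Lemma hdist_rest p k : dirs p k -> 0 < len k.1 - hdist p k.
Proof. by move=> /hdist_bounds/andP[_]; rewrite subr_gt0. Qed.

Lemma Delta_dirs p k : 0 < lambda_T lam p -> dirs p k ->
  dirs_in (@trop R X @` Delta) p k.
Proof.
move=> M0 pk; rewrite /dirs_in pk; apply/asboolP.
have [j jM] := lambda_T_attained M0.
have [eps e0 Heps] := small_lt 0 (expected_slope j k) M0.
exists (Num.min eps (len k.1 - hdist p k)).
  by rewrite lt_min e0 hdist_rest.
move=> s; rewrite le_min => /andP[s0 /andP[se sl]].
have [x Ex] := trop_surj (travel p k s).
exists x => //; case: hDelta => _ sub _; apply: sub; left.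
rewrite /= /lambda /= Ex; apply: lt_le_trans (lambda_T_ge j _).
have := Heps s; rewrite travel_slope ?s0 // se => /(_ isT).
by rewrite jM mul0r addr0.
Qed.

Lemma lambda_T_slope p k j m : 0 < lambda_T lam p -> dirs p k ->
  lam j p = lambda_T lam p -> expected_slope j k = m ->
  (forall i, lam i p = lambda_T lam p -> expected_slope i k = m) ->
  is_slope (lambda_T lam) p k m.
Proof.
move=> M0 pk jM jm same; set M := lambda_T lam p in M0 jM same *.
have rest0 := hdist_rest pk.
have [e1 e10 H1] : exists2 eps : R, 0 < eps & forall s, 0 <= s <= eps ->
    forall i, lam i (travel p k s) <= M + m * s.
  apply: small_forall => i.
  have [E|ne] := eqVneq (lam i p) M.
    exists (len k.1 - hdist p k) => // s sl.
    by rewrite travel_slope // E same.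
  have lt : lam i p < M by rewrite lt_neqAle ne lambda_T_ge.
  have [eps e0 Heps] := small_lt (expected_slope i k) m lt.
  exists (Num.min eps (len k.1 - hdist p k)); first by rewrite lt_min e0.
  move=> s; rewrite le_min => /andP[s0 /andP[se sl]].
  by rewrite travel_slope ?s0 // ltW // Heps // s0.
have [e2 e20 H2] := small_lt 0 m M0.
exists (Num.min (Num.min e1 e2) (len k.1 - hdist p k)).
  by rewrite !lt_min e10 e20.
move=> s; rewrite !le_min => /andP[s0 /andP[/andP[s1 s2] sl]].
apply/eqP; rewrite eq_le; apply/andP; split.
  apply/bigmax_leP; split=> [|i _]; last by apply: H1; rewrite s0.
  by have := H2 s; rewrite s0 s2 mul0r addr0 => /(_ isT)/ltW.
apply: le_trans (lambda_T_ge j _).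
by rewrite travel_slope ?s0 // jM jm.
Qed.

(* Otherwise all the functions attaining the maximum have the same slopes at p,
   and the special divisor is 0 there. *)
Lemma special_maximizer p h : 0 < lambda_T lam p ->
  special_divisor lam Delta p != 0 -> dirs p h ->
  exists2 j, lam j p = lambda_T lam p & j \notin far h.
Proof.
move=> M0 Dp ph; apply: contrapT => none.
have inh j : lam j p = lambda_T lam p -> j \in far h.
  by move=> jM; apply: contrapT => /negP jh; apply: none; exists j.
have [j jM] := lambda_T_attained M0.
have same i k : dirs p k -> lam i p = lambda_T lam p ->
    expected_slope i k = expected_slope j k.
  move=> pk iM; rewrite /expected_slope; congr (_ - _%:R).
  have [->|kh] := eqVneq k h; first by rewrite !inh.
  by rewrite !(negbTE (dirs_disjoint ph pk kh _)) // inh.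
have eq_dirs : dirs_in (@trop R X @` Delta) p =1 dirs p.
  move=> k; apply/idP/idP => [/andP[]//|]; exact: Delta_dirs.
have [[_ div_j] _] := hlam j.
move: Dp; rewrite /special_divisor.
have -> : pdiv_on (@trop R X @` Delta) (lambda_T lam) p = Defs.pdiv (lam j) p.
  rewrite /pdiv_on /Defs.pdiv (eq_bigl _ _ eq_dirs); apply: eq_bigr => k pk.
  rewrite (slopeE (m := expected_slope j k)); last first.
    by apply: (lambda_T_slope (j := j)) => // i; apply: same.
  apply/esym/slopeE/linear_is_slope => //; apply: admissible_linear.
  by case: (hlam j).
have -> : Dprime_on (@trop R X @` Delta) p = Dprime p.
  rewrite /Dprime_on /Dprime (eq_card (B := dirs p)); last exact: eq_dirs.
  rewrite [X in (_ + X)%N]eq_card0 ?addn0 // => k; rewrite !inE eq_dirs.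
  by case: (dirs p k).
rewrite div_j; case: (p =P inl j) => [pj|]; last by rewrite mulr0n eqxx.
move: ph; rewrite pj /= => /eqP rh.
by have := hroot_far tree h; rewrite rh inh.
Qed.

End Special.

Theorem lemma3p22 (R : realType) (X : weighted_cover R)
    (lam : gV (Tree X) -> mpoint (Tree X) -> R)
    (Delta Core : set (mpoint (Gam X))) (rho1 : R)
    (hlam : shifted_admissible_family lam)
    (hDelta : is_Delta lam Delta)
    (hrho1 : is_rho1 lam Delta rho1)
    (hCore : is_core Core) :
  Core `<=` superlevel lam rho1.
Proof.
move=> x Cx; rewrite /superlevel /=; case: hrho1 => q [_ Dq] <-.
rewrite /lambda /=.
case: (leP (lambda_T lam (trop q)) 0) => [le0|M0].
  exact: le_trans le0 (lambda_T_ge0 _ _).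
case: (pselect (trop x = trop q)) => [->//|ne].
have [h way] := exists_toward ne; have [qh _] := way.
have [j jM jh] := special_maximizer hlam hDelta M0 Dq qh.
rewrite -jM; apply: le_trans (lambda_T_ge _ j _).
have [adm _] := hlam j; apply: (ascent adm way jh) => k.
exact: core_branches hCore Cx.
Qed.
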